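(* Let $m\geq 2$ be an integer. For any $c\in(0,1]$, the set $$Di_m(c)\setminus\Big(\bigcup_{\epsilon>0}Di_m(c-\epsilon)\cup Bad_m\Big)$$ has packing dimension at least $m-1$. In particular, the same applies to the set $$\boldsymbol{FS}_m:=Di_m\setminus(Bad_m\cup Sing_m).$$
   Context: For $x\in\mathbb{R}$ let $\Vert x\Vert$ be the distance of $x$ to the nearest integer, and for $\underline{x}\in\mathbb{R}^m$ let $\Vert\underline{x}\Vert=\max_{1\leq i\leq m}\Vert x_i\Vert$. For $\underline{\xi}\in\mathbb{R}^m$ and $Q\geq 1$ let $\psi_{\underline{\xi}}(Q)=\min_{1\leq q\leq Q}\Vert q\underline{\xi}\Vert$, $q$ ranging over positive integers. For real $c$, $Di_m(c)$ is the set of $\underline{\xi}\in\mathbb{R}^m$ for which there is $Q_0$ with $\psi_{\underline{\xi}}(Q)\leq cQ^{-1/m}$ for all $Q\geq Q_0$. The set of Dirichlet improvable vectors is $Di_m=\bigcup_{c<1}Di_m(c)$. The set of badly approximable vectors is $Bad_m=\{\underline{\xi}\in\mathbb{R}^m:\liminf_{Q\to\infty}Q^{1/m}\psi_{\underline{\xi}}(Q)>0\}$. The set of singular vectors is $Sing_m=\{\underline{\xi}\in\mathbb{R}^m:\lim_{Q\to\infty}Q^{1/m}\psi_{\underline{\xi}}(Q)=0\}=\bigcap_{c>0}Di_m(c)$. *)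

(* Defs.v *)
From HB Require Import structures.
From mathcomp Require Import all_boot all_order all_algebra.
From mathcomp Require Import all_classical all_reals all_analysis.

Set Implicit Arguments.
Unset Strict Implicit.
Unset Printing Implicit Defensive.

Import Order.TTheory GRing.Theory Num.Theory.
Import numFieldTopology.Exports numFieldNormedType.Exports.

Local Open Scope classical_set_scope.
Local Open Scope ring_scope.

Section UniformApproximation.
Variable R : realType.

Definition dist_int (x : R) : R := inf [set `|x - n%:~R| | n in [set: int]].

Definition dist_intv (m : nat) (x : 'rV[R]_m) : R :=
  \big[Num.max/0]_(i < m) dist_int (x ord0 i).

(* For [1 <= Q] the infimum ranges over a nonempty finite set, hence is a
   minimum; for [Q < 1] it is the junk value [0]. *)
Definition psi (m : nat) (xi : 'rV[R]_m) (Q : R) : R :=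
  inf [set dist_intv (q%:R *: xi) | q in [set q : nat | (0 < q)%N /\ q%:R <= Q]].

Definition Di (m : nat) (c : R) : set 'rV[R]_m :=
  [set xi | exists2 Q0 : R, 1 <= Q0 &
    forall Q : R, Q0 <= Q -> psi xi Q <= c * Q `^ (- m%:R^-1)].
Arguments Di m c : clear implicits.

Definition DirichletImprovable (m : nat) : set 'rV[R]_m :=
  \bigcup_(c in [set c : R | c < 1]) Di m c.

Definition Bad (m : nat) : set 'rV[R]_m :=
  [set xi | (0 < limf_einf (fun Q : R => (Q `^ (m%:R^-1) * psi xi Q)%:E)
                           (+oo%R : set_system R))%E].

Definition Sing (m : nat) : set 'rV[R]_m :=
  [set xi | Q `^ (m%:R^-1) * psi xi Q @[Q --> +oo] --> (0 : R)].

Arguments DirichletImprovable m : clear implicits.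
Arguments Bad m : clear implicits.
Arguments Sing m : clear implicits.

Definition FS (m : nat) : set 'rV[R]_m :=
  DirichletImprovable m `\` (Bad m `|` Sing m).

End UniformApproximation.

Arguments Di {R} m c.
Arguments DirichletImprovable R m : clear implicits.
Arguments Bad R m : clear implicits.
Arguments Sing R m : clear implicits.
Arguments FS R m : clear implicits.

(* [R^m] carries the sup norm of ['rV[R]_m]; packing dimension does not depend
   on the choice of a norm. *)
Section PackingDimension.
Variables (R : realType) (m : nat).
Implicit Types (E : set 'rV[R]_m) (s delta : R).

(* A finite or countable packing of [E]: the balls are indexed by an arbitrary
   [D : set nat]. *)
Definition is_packing delta E (D : set nat) (x : nat -> 'rV[R]_m)
    (r : nat -> R) : Prop :=
  (forall i, D i -> E (x i) /\ 0 < r i <= delta) /\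
  trivIset D (fun i => closed_ball (x i) (r i)).

(* For [0 < m], [2 * r i] is the diameter of the closed sup-norm ball of
   radius [r i]. *)
Definition packing_content s delta E : \bar R :=
  ereal_sup [set y : \bar R | exists (D : set nat) x r,
    is_packing delta E D x r /\
    y = (\esum_(i in D) ((2 * r i) `^ s)%:E)%E].

(* [packing_content s delta E] is nondecreasing in [delta], so the infimum is
   its limit as [delta] tends to [0+]. *)
Definition packing_premeasure s E : \bar R :=
  ereal_inf [set packing_content s delta E | delta in [set delta | 0 < delta]].

Definition packing_measure s E : \bar R :=
  ereal_inf [set y : \bar R | exists F : nat -> set 'rV[R]_m,
    E `<=` \bigcup_i F i /\
    y = (\sum_(0 <= i <oo) packing_premeasure s (F i))%E].

Definition packing_dim E : \bar R :=
  ereal_inf [set s%:E | s in [set s : R | 0 <= s /\ packing_measure s E = 0%E]].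

End PackingDimension.

(* Main.v *)
Require Import Defs.
From HB Require Import structures.
From mathcomp Require Import all_boot all_order all_algebra.
From mathcomp Require Import all_classical all_reals all_analysis.
From mathcomp Require Import ring lra zify.
Import Order.TTheory GRing.Theory Num.Theory.
Import numFieldTopology.Exports numFieldNormedType.Exports.
Local Open Scope classical_set_scope.
Local Open Scope ring_scope.
Set Implicit Arguments.
Unset Strict Implicit.
Unset Printing Implicit Defensive.

(** Write m = n + 1.  It is enough to find, for every eta in some dense
    G_delta set of R^n, one real zeta such that xi = (zeta, eta) lies in the
    set under study.  The projection to R^n is 1-Lipschitz for the sup norm and
    maps the set onto something comeagre.  If countably many sets F_i cover
    the set, then by Baire the projection of some F_i is dense in a ball of
    R^n, so F_i contains, for every large M, about M^n points at mutual
    distance of order 1/M; hence its packing premeasure in dimension s is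
    infinite for every s < n ([packing_content_infty],
    [packing_dim_ge_proj]).

    The generic eta are the vectors extremely close, for infinitely many h
    with prescribed divisors, to rational points (u_0/h, u_1/h^2, ...,
    u_{n-1}/h^n) with every u_j coprime to h.  These points are dense, and they
    are optimally badly approximable among rational points of denominator
    q = h^n: if 0 < nu and h^n does not divide nu, some coordinate of nu times
    the point is at distance at least 1/h = q^(-1/n) from the integers.

    Given such an eta, pick h_0, h_1, ... growing very fast and put
    zeta = sum_k 1/b_k, with b_k = a_k h_k^n, where the b_k divide h_{k+1} and
    a_k is the least integer for which 1/a_k is (slightly) below
    c b_k^(-1/m).  As Q grows from h_k^n to h_{k+1}^n, psi behaves as follows.
    - For h_k^n <= Q < b_k: h_k^n zeta is an integer plus about 1/a_k and
      h_k^n eta is nearly integral, so q = h_k^n gives psi <= c Q^(-1/m); and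
      no q < b_k does better than about 1/a_k, because multiples of h_k^n are
      controlled by zeta and the other q by eta.  So the constant c is
      approached just before b_k ([stage_psi_hn], [stage_dist_lower],
      [stage_sharp]).
    - At b_k both b_k zeta and b_k eta are tiny modulo 1.  This gives the bound
      up to a large power of b_k, and shows that Q^(1/m) psi has lower limit
      0, i.e. xi is not badly approximable ([stage_psi_b],
      [stage_psi_at_b]).
    - From there on up to h_{k+1}^n, multiples nu b_k of b_k keep zeta close to
      the integers, and Dirichlet's theorem in dimension n applied to b_k eta
      yields the exponent 1/n, which beats 1/m for Q large compared with b_k
      ([stage_psi_gap]).
    The statement on FS is the case c = 1/2, a singular vector being in
    Di(1/4). *)

(** * Packing dimension and projections *)

(** Joins the completeness and the norm of matrices, so that Baire's theorem
    applies to [R^n]. *)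
HB.instance Definition _ (R : realType) (m n : nat) :=
  Complete.on 'M[R]_(m, n).

Section Packing.
Variable R : realType.

Lemma coord_le_norm n (x : 'rV[R]_n) j : `|x ord0 j| <= `|x|.
Proof.
rewrite [leRHS]/Num.Def.normr/= mx_normrE; apply/bigmax_geP; right => /=.
by exists (ord0, j).
Qed.

Lemma norm_lt_coord n (x : 'rV[R]_n) (e : R) :
  0 < e -> (forall j, `|x ord0 j| < e) -> `|x| < e.
Proof.
move=> e0 xe; rewrite [ltLHS]/Num.Def.normr/= mx_normrE; apply/bigmax_ltP.
by split=> // -[i j] _ /=; rewrite (ord1 i).
Qed.

Lemma closure_norm n (A : set 'rV[R]_n) x e :
  closure A x -> 0 < e -> exists2 y, A y & `|x - y| < e.
Proof.
move=> cA e0; have [y [Ay yx]] := cA _ (nbhsx_ballx x e e0).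
by exists y => //; move: yx; rewrite -ball_normE.
Qed.

Lemma natr_powR_unbounded (t A : R) : 0 < t ->
  exists M0 : nat, forall M : nat, (M0 <= M)%N -> A <= M%:R `^ t.
Proof.
move=> t0; have [A0|A0] := leP A 0.
  by exists 0%N => M _; rewrite (le_trans A0)// powR_ge0.
exists (Num.bound (A `^ t^-1)) => M le_M.
have AM : A `^ t^-1 <= M%:R.
  by rewrite (le_trans (ltW (archi_boundP (powR_ge0 _ _))))// ler_nat.
have -> : A = (A `^ t^-1) `^ t by rewrite -powRrM mulVf ?gt_eqF// powRr1// ltW.
by rewrite ge0_ler_powR// ?nnegrE ?powR_ge0// ltW.
Qed.

Lemma esum_const_lt K (a : R) : 0 <= a ->
  (\esum_(i in `I_K) a%:E)%E = (K%:R * a)%:E.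
Proof.
move=> a0; rewrite esum_fset//.
by rewrite -fsbig_ord sumEFin sumr_const card_ord mulr_natl.
Qed.

(** Two points within [r] of grid points a step [5 * r] apart cannot both be
    within [r] of the same [z]: this makes the balls in a packing disjoint. *)
Lemma grid_gap (a b y1 y2 z r : R) : `|a - y1| < r -> `|b - y2| < r ->
  `|y1 - z| <= r -> `|y2 - z| <= r -> 5 * r <= `|a - b| -> False.
Proof.
rewrite ler_normr !ler_norml !ltr_norml.
move=> /andP[? ?] /andP[? ?] /andP[? ?] /andP[? ?].
by case/orP=> ?; lra.
Qed.

(** The ball contains a grid of [M ^ n] points with step [5 * r], where [r] is
    proportional to [1 / M].  Points of [F] whose projections are [r]-close to the
    grid points are centres of disjoint balls of radius [r], and
    [M ^ n * (2 * r) `^ s] is of order [M `^ (n - s)], which is unbounded. *)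
Lemma packing_content_infty n (F : set 'rV[R]_n.+1) (x0 : 'rV[R]_n)
    (rho s delta : R) :
  0 < rho -> s < n%:R -> 0 < delta ->
  ball x0 rho `<=` closure (col' ord0 @` F) ->
  packing_content s delta F = +oo%E.
Proof.
move=> rho0 sn delta0 dF; apply/eqyP => A A0.
(* The sum over [M ^ n] balls is [(2 * rho / 5) `^ s * M `^ (n - s)]: it is at
   least [A] as soon as [M `^ (n - s)] is at least [B]. *)
pose B := A / (2 * rho / 5) `^ s.
have [M0 hM0] := @natr_powR_unbounded (n%:R - s) B ltac:(by rewrite subr_gt0).
pose M := (maxn M0 (Num.bound (rho / (5 * delta)))).+1.
have BM : B <= M%:R `^ (n%:R - s).
  by apply: hM0; rewrite leqW// leq_maxl.
have M0' : (0 : R) < M%:R by rewrite ltr0n.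
pose r := rho / (5 * M%:R).
have r0 : 0 < r by rewrite divr_gt0// mulr_gt0.
have rdelta : r <= delta.
  have : rho / (5 * delta) <= M%:R.
    rewrite ltW// (lt_le_trans (archi_boundP _))//.
      by rewrite divr_ge0 ?mulr_ge0// ltW.
    by rewrite ler_nat leqW// leq_maxr.
  rewrite /r !ler_pdivrMr ?mulr_gt0//; lra.
pose g (f : {ffun 'I_n -> 'I_M}) : 'rV[R]_n :=
  x0 + \row_j (5 * r * (f j : nat)%:R).
have gP f : exists y, F y /\ `|g f - col' ord0 y| < r.
  have [|z [y Fy <-] gy] := @closure_norm _ (col' ord0 @` F) (g f) r _ r0; [|by exists y].
  apply: dF; rewrite -ball_normE /ball_/=; apply: norm_lt_coord => // j.
  rewrite !mxE opprD addNKr normrN ger0_norm; last first.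
    by rewrite mulr_ge0// mulr_ge0// ltW.
  have -> : 5 * r = rho / M%:R.
    by rewrite /r; field; rewrite gt_eqF.
  by rewrite mulrAC ltr_pdivrMr// ltr_pM2l// ltr_nat.
have [Y YP] := choice gP.
pose e k := nth [ffun=> ord0] (enum {ffun 'I_n -> 'I_M}) k.
have eN : size (enum {ffun 'I_n -> 'I_M}) = (M ^ n)%N.
  by rewrite -cardE card_ffun !card_ord.
apply: (@le_trans _ _ (\esum_(i in `I_(M ^ n)) ((2 * r) `^ s)%:E)%E).
  rewrite esum_const_lt ?powR_ge0// lee_fin.
  have -> : 2 * r = (2 * rho / 5) * M%:R^-1.
    by rewrite /r; field; rewrite gt_eqF.
  have rho2 : 0 < 2 * rho / 5 by lra.
  have M1 : 0 < M%:R^-1 :> R by rewrite invr_gt0.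
  rewrite powRM; [|exact: ltW..].
  rewrite natrX mulrCA -ler_pdivrMl ?powR_gt0//.
  rewrite (mulrC _ A) (le_trans BM)// powRB ?gt_eqF ?implybT//.
  by rewrite powR_mulrn ?ler0n// -(powR_inv1 (ler0n _ M)) -powRrM mulN1r powRN.
apply: ereal_sup_ubound; exists `I_(M ^ n), (Y \o e), (fun=> r); split => //.
split=> [i _|]; first by split; [have [] := YP (e i)|rewrite r0].
move=> i j /= iM jM [z []]; rewrite closed_ballE// closed_ballE// /closed_ball_/=.
move=> zi zj.
have [eij|neij] := eqVneq (e i) (e j).
  by apply/eqP; rewrite -(nth_uniq [ffun=> ord0] _ _ (enum_uniq {ffun 'I_n -> 'I_M})) ?eN//; apply/eqP.
have [k fk] : exists k, e i k != e j k.
  apply/existsP; rewrite -negb_forall; apply: contra neij => /forallP h.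
  by apply/eqP/ffunP => k; apply/eqP.
(* Distinct grid points differ by at least one step in coordinate [k]. *)
have far : 5 * r <= `|g (e i) ord0 k - g (e j) ord0 k|.
  rewrite !mxE opprD addrACA subrr add0r -mulrBr normrM.
  have r50 : 0 <= 5 * r by rewrite mulr_ge0// ltW.
  rewrite (ger0_norm r50) ler_peMr//.
  have : (e i k : nat) != (e j k : nat) by apply: contra fk => /eqP/val_inj ->.
  rewrite neq_ltn => /orP[] lt_e.
    by rewrite distrC ler_normr lerBrDr nat1r ler_nat lt_e.
  by rewrite ler_normr lerBrDr nat1r ler_nat lt_e.
have near_ f : `|g f ord0 k - Y f ord0 (lift ord0 k)| < r.
  have [_] := YP f; apply: le_lt_trans.
  by rewrite (le_trans _ (coord_le_norm _ k))// !mxE.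
have := le_trans (coord_le_norm _ (lift ord0 k)) zi.
have := le_trans (coord_le_norm _ (lift ord0 k)) zj.
rewrite !mxE => zj' zi'.
by case: (grid_gap (near_ _) (near_ _) zi' zj' far).
Qed.

Lemma packing_premeasure_ge0 n s (F : set 'rV[R]_n) :
  (0 <= packing_premeasure s F)%E.
Proof.
apply/ereal_infP => _ [delta /= d0 <-].
apply: ereal_sup_ubound; exists set0, (fun=> 0), (fun=> 0); split.
  by split=> // i j [].
by rewrite esum_set0.
Qed.

(** A set projecting onto a comeagre subset of [R^n] has packing dimension at
    least [n]: were the projection of each piece of a countable cover nowhere
    dense, the complements of the closures would meet the [G B] in a common
    point, whose preimage in [E] would lie in no piece. *)
Lemma packing_dim_ge_proj n (E : set 'rV[R]_n.+1)
    (G : nat -> set 'rV[R]_n) :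
  (forall B, open (G B) /\ dense (G B)) ->
  (forall eta, (forall B, G B eta) -> exists2 xi, E xi & col' ord0 xi = eta) ->
  (n%:R%:E <= packing_dim E)%E.
Proof.
move=> odG GE; apply/ereal_infP => _ [s [s0 Es0] <-].
rewrite lee_fin leNgt; apply/negP => sn.
suff : packing_measure s E = +oo%E by rewrite Es0.
apply: (proj2 (ereal_inf_pinfty _)) => _ [F [EF ->]].
suff [i [x0 [rho rho0 dF]]] : exists i x0, exists2 rho : R, 0 < rho &
    ball x0 rho `<=` closure (col' ord0 @` F i).
  apply: (@nneseries_pinfty _ _ _ i) => //.
    by move=> k _; exact: packing_premeasure_ge0.
  apply: (proj2 (ereal_inf_pinfty _)) => _ [delta /= d0 <-].
  exact: packing_content_infty dF.
apply: contrapT => noball.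
pose U k := G k `&` ~` closure (col' ord0 @` F k).
have odU k : open (U k) /\ dense (U k).
  have [oG dG] := odG k.
  have oC : open (~` closure (col' ord0 @` F k)).
    by apply: closed_openC; exact: closed_closure.
  split; first exact: openI.
  move=> O [x Ox] oO; have [y [Oy Cy]] : O `&` ~` closure (col' ord0 @` F k) !=set0.
    apply: contrapT => Oe; apply: noball; exists k, x.
    have /nbhs_ballP[rho rho0 xO] := open_nbhs_nbhs (conj oO Ox).
    exists rho => // y /xO Oy; apply: contrapT => Cy; apply: Oe.
    by exists y.
  have [z [[Oz Cz] Gz]] := dG _ (ex_intro _ y (conj Oy Cy)) (openI oO oC).
  by exists z.
have [eta [_ Ueta]] := Baire odU (ex_intro [set: 'rV[R]_n] 0 I) openT.
have [xi Exi xieta] := GE eta (fun B => (Ueta B I).1).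
have [i _ Fi] := EF _ Exi.
by apply: (Ueta i I).2; apply: subset_closure; exists xi.
Qed.

End Packing.

(** * Distance to the integers and the function psi *)

Section Distance.
Variable R : realType.
Implicit Types (x L c Q : R).

Lemma dist_int_le x (k : int) : dist_int x <= `|x - k%:~R|.
Proof.
apply: ge_inf; last by exists k.
by exists 0 => _ [j _ <-].
Qed.

Lemma dist_int_ge x L : (forall k : int, L <= `|x - k%:~R|) -> L <= dist_int x.
Proof.
move=> h; apply: lb_le_inf; first by exists `|x - 0%:~R|, 0.
by move=> _ [k _ <-].
Qed.

Lemma dist_intv_le m (xi : 'rV[R]_m) L : 0 <= L ->
  (forall i, dist_int (xi ord0 i) <= L) -> dist_intv xi <= L.
Proof. by move=> L0 h; apply/bigmax_leP; split. Qed.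

Lemma dist_int_coord m (xi : 'rV[R]_m) i :
  dist_int (xi ord0 i) <= dist_intv xi.
Proof. by rewrite /dist_intv (bigD1 i)//= le_max lexx. Qed.

Lemma dist_intv_ge0 m (xi : 'rV[R]_m) : 0 <= dist_intv xi.
Proof.
by apply/bigmax_geP; left.
Qed.

Lemma psi_le m (xi : 'rV[R]_m) Q (q : nat) : (0 < q)%N -> q%:R <= Q ->
  psi xi Q <= dist_intv (q%:R *: xi).
Proof.
move=> q0 qQ; apply: ge_inf; last by exists q.
by exists 0 => _ [j _ <-]; exact: dist_intv_ge0.
Qed.

Lemma psi_ge m (xi : 'rV[R]_m) Q L : 1 <= Q ->
  (forall q : nat, (0 < q)%N -> q%:R <= Q -> L <= dist_intv (q%:R *: xi)) ->
  L <= psi xi Q.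
Proof.
move=> Q1 h; apply: lb_le_inf; first by exists (dist_intv (1%:R *: xi)), 1%N.
by move=> _ [q [q0 qQ] <-]; exact: h.
Qed.

Lemma psi_ge0 m (xi : 'rV[R]_m) Q : 1 <= Q -> 0 <= psi xi Q.
Proof. by move=> Q1; apply: psi_ge => // q _ _; exact: dist_intv_ge0. Qed.

(** Turns bounds with a real exponent into polynomial inequalities. *)
Lemma le_mul_powRN (m : nat) x c Q : (0 < m)%N -> 0 <= x -> 0 <= c -> 0 < Q ->
  (x <= c * Q `^ (- m%:R^-1)) = (x ^+ m * Q <= c ^+ m).
Proof.
move=> m0 x0 c0 Q0.
rewrite powRN ler_pdivlMr ?powR_gt0//.
rewrite -(@ler_pXn2r _ m)// ?nnegrE ?mulr_ge0 ?powR_ge0//.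
rewrite exprMn -[in X in _ * X](powR_mulrn m (powR_ge0 _ _)) -powRrM.
by rewrite mulVf ?pnatr_eq0 ?lt0n_neq0// powRr1// ltW.
Qed.

(** Dirichlet's theorem up to the constant [2 ^ n], by pigeonhole: with [M] the
    integer part of the n-th root of [N], the [N + 1] points [k *: y] modulo 1 fall
    into [M ^ n <= N] boxes of side [1 / M]. *)
Lemma weak_dirichlet n (y : 'rV[R]_n) (N : nat) : (0 < n)%N -> (0 < N)%N ->
  exists nu : nat, [/\ (0 < nu)%N, (nu <= N)%N &
    dist_intv (nu%:R *: y) ^+ n * N%:R <= 2 ^+ n].
Proof.
move=> n0 N0.
have [|k|M MN maxM] := @ex_maxnP (fun M => (M ^ n <= N)%N) N.
- by exists 1%N; rewrite exp1n.
- by apply: leq_trans; rewrite -{1}(expn1 k); case: (k) => [|k']; rewrite ?exp0n// leq_pexp2l.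
have M0 : (0 < M)%N by apply: maxM; rewrite exp1n.
have NM : (N < M.+1 ^ n)%N.
  by rewrite ltnNge; apply/negP => /maxM; rewrite ltnn.
have MR : (0 : R) < M%:R by rewrite ltr0n.
case: M M0 MN maxM NM MR => // M _ MN maxM NM MR.
pose fr (k : nat) j : R := k%:R * y ord0 j - (Num.floor (k%:R * y ord0 j))%:~R.
have fr_itv k j : 0 <= fr k j < 1.
  by rewrite /fr subr_ge0 floor_le ltrBlDl -[X in _ < _ + X]/(1%:~R) -intrD floorD1_gt.
pose f (k : 'I_N.+1) : {ffun 'I_n -> 'I_M.+1} :=
  [ffun j => inord (Num.truncn (M.+1%:R * fr k j))].
have fE k j : (f k j : nat) = Num.truncn (M.+1%:R * fr k j).
  have /andP[f0 f1] := fr_itv k j.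
  rewrite ffunE inordK// truncn_lt_nat ?mulr_ge0//.
  by rewrite gtr_pMr.
have /injectivePn[k1 [k2 k12 fk]] : ~~ injectiveb f.
  apply: contraL MN => /injectiveP/leq_card.
  by rewrite card_ffun !card_ord -ltnNge.
wlog lt_k : k1 k2 k12 fk / (k1 < k2)%N.
  move=> H; have [|k21] := ltnP k1 k2; first exact: H.
  by apply: (H k2 k1) => //; rewrite ?[_ == k1]eq_sym// ltn_neqAle eq_sym k12.
exists (k2 - k1)%N; split; first by rewrite subn_gt0.
  by rewrite (leq_trans (leq_subr _ _))// -ltnS.
have dM : dist_intv ((k2 - k1)%:R *: y) <= M.+1%:R^-1.
  apply: dist_intv_le => [|j]; first by rewrite invr_ge0.
  rewrite mxE natrB ?(ltnW lt_k)//.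
  rewrite (le_trans (dist_int_le _ (Num.floor (k2%:R * y ord0 j) - Num.floor (k1%:R * y ord0 j))))//.
  have -> : (k2%:R - k1%:R) * y ord0 j -
      (Num.floor (k2%:R * y ord0 j) - Num.floor (k1%:R * y ord0 j))%:~R =
      fr k2 j - fr k1 j by rewrite /fr rmorphB/=; ring.
  have := fE k1 j; rewrite fk fE => tr.
  have /andP[f10 f11] := fr_itv k1 j; have /andP[f20 f21] := fr_itv k2 j.
  have /andP[A1 B1] := truncn_itv (mulr_ge0 (ltW MR) f10).
  have /andP[A2 B2] := truncn_itv (mulr_ge0 (ltW MR) f20).
  rewrite -(ler_pM2l MR) mulfV ?gt_eqF// -[X in X * _]ger0_norm ?(ltW MR)//.
  rewrite -normrM mulrBr ler_norml; move: A1 B1 A2 B2; rewrite tr -natr1.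
  set t := (Num.truncn _)%:R; set p := _ * fr k1 j; set q := _ * fr k2 j.
  by move=> *; apply/andP; split; lra.
rewrite (@le_trans _ _ (M.+1%:R^-1 ^+ n * M.+2%:R ^+ n))//.
  apply: ler_pM; rewrite ?exprn_ge0 ?dist_intv_ge0//.
    by rewrite ler_pXn2r ?nnegrE ?dist_intv_ge0 ?invr_ge0.
  by rewrite -natrX ler_nat ltnW.
rewrite -exprMn ler_pXn2r ?nnegrE ?mulr_ge0 ?invr_ge0//.
by rewrite ler_pdivrMl// -natrM ler_nat mulnC; lia.
Qed.

End Distance.

(** * Vectors well approximable by ladders of fractions *)

Section WellApproximable.
Variables (R : realType) (n : nat) (eps : nat -> R).

(** The denominators [h, h^2, ..., h^n] are chosen so that the lattice generated
    by the integer vectors and the rational point contains no nonzero vector of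
    sup norm below [1 / h], the largest value that its covolume [h ^- n]
    allows. *)
Definition ladder_approx (h : nat) : set 'rV[R]_n :=
  [set eta | exists u : 'I_n -> int, (forall j, coprimez (u j) h) /\
    `|eta - \row_j ((u j)%:~R / h%:R ^+ j.+1)| < eps h].

(** [B.+1] serves both as a lower bound and as a prescribed divisor of [h]. *)
Definition ladder_approx_beyond (B : nat) : set 'rV[R]_n :=
  [set eta | exists h : nat,
    [/\ (B < h)%N, (B.+1 %| h)%N & ladder_approx h eta]].

Lemma open_ladder_approx_beyond B : open (ladder_approx_beyond B).
Proof.
rewrite openE => eta [h [Bh Bdvd [u [cu lt_eps]]]]; apply/nbhs_ballP.
exists (eps h - `|eta - \row_j ((u j)%:~R / h%:R ^+ j.+1)|) => /=.
  by rewrite subr_gt0.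
move=> y; rewrite -ball_normE /ball_/= => ylt.
exists h; split=> //; exists u; split=> //.
rewrite (le_lt_trans (ler_distD eta _ _))// (distrC y).
by rewrite -ltrBrDr.
Qed.

Hypothesis eps_gt0 : forall h, (0 < h)%N -> 0 < eps h.

(** Take [h] a large power of [D = 2 * B.+1]; the numerators
    congruent to 1 modulo [D] are coprime to [h], and the fractions they form have
    spacing at most [D / h]. *)
Lemma dense_ladder_approx_beyond B : dense (ladder_approx_beyond B).
Proof.
move=> O [x Ox] oO.
have /nbhs_ballP[rho /= rho0 xO] := open_nbhs_nbhs (conj oO Ox).
pose D := (2 * B.+1)%N; have D2 : (1 < D)%N by rewrite /D; lia.
have D0 : (0 : R) < D%:R by rewrite ltr0n ltnW.
pose s := (Num.bound (2 * D%:R / rho)).+1.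
pose h := (D ^ s)%N.
have h0 : (0 : R) < h%:R by rewrite ltr0n expn_gt0 ltnW.
have hbig : 2 * D%:R / rho < h%:R.
  rewrite (lt_le_trans (archi_boundP _))//.
    by rewrite divr_ge0 ?mulr_ge0// ltW.
  by rewrite ler_nat ltnW// ltnW// ltn_expl.
pose u (j : 'I_n) : int :=
  1 + D%:Z * Num.floor (x ord0 j * h%:R ^+ j.+1 / D%:R).
have cu j : coprimez (u j) h.
  suff : coprimez (u j) D by rewrite !coprimezE /h; exact: coprimeXr.
  apply/coprimezP; exists (1, - Num.floor (x ord0 j * h%:R ^+ j.+1 / D%:R)) => /=.
  by rewrite /u; ring.
pose v : 'rV[R]_n := \row_j ((u j)%:~R / h%:R ^+ j.+1).
exists v; split; last first.
  exists h; split.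
  - have Dh : (D <= h)%N by rewrite /h /s expnS leq_pmulr// expn_gt0 ltnW.
    by rewrite (leq_trans _ Dh)// /D; lia.
  - by rewrite /h expnS dvdn_mulr// dvdn_mull.
  - exists u; split=> //; rewrite subrr normr0 eps_gt0//.
    by rewrite -(ltr0n R).
apply: xO; rewrite -ball_normE /ball_/=; apply: norm_lt_coord => // j.
rewrite !mxE /u rmorphD rmorphM/= -[_%:~R in X in _ + X * _]/(D%:R).
set F := Num.floor _.
have hj0 : (0 : R) < h%:R ^+ j.+1 by rewrite exprn_gt0.
have xj : x ord0 j = D%:R * (x ord0 j * h%:R ^+ j.+1 / D%:R) / h%:R ^+ j.+1.
  by field; rewrite !gt_eqF.
have F1 : F%:~R <= x ord0 j * h%:R ^+ j.+1 / D%:R by exact: floor_le.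
have F2 : x ord0 j * h%:R ^+ j.+1 / D%:R < F%:~R + 1.
  by rewrite -[X in _ < _ + X]/(1%:~R) -intrD floorD1_gt.
rewrite {1}xj -mulrBl normrM [X in _ * X]gtr0_norm ?invr_gt0// ltr_pdivrMr//.
move: F1 F2; set t := _ / D%:R; set f := F%:~R => F1 F2.
have hh : 2 * D%:R < rho * h%:R ^+ j.+1.
  move: hbig; rewrite ltr_pdivrMr// mulrC => /lt_le_trans; apply.
  rewrite mulrC ler_pM2l// exprS ler_peMr ?ler0n//.
  by rewrite exprn_ege1// ler1n -(ltr0n R).
apply: le_lt_trans hh; have D1 : (1 : R) < D%:R by rewrite ltr1n.
have E1 : 0 <= D%:R * (t - f) by apply: mulr_ge0; rewrite ?subr_ge0.
have E2 : D%:R * (t - f) <= D%:R.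
  by rewrite -[leRHS]mulr1 ler_pM2l// lerBlDl ltW.
by rewrite -[1%:~R]/(1 : R) ler_norml; apply/andP; split; nra.
Qed.

End WellApproximable.

(** * Approximations between two consecutive scales *)

Lemma int_norm_ge1 (R : realType) (k : int) : k != 0 -> 1 <= `|k%:~R : R|.
Proof. by move=> k0; rewrite -intr_norm ler1z -gtz0_ge1 normr_gt0. Qed.

Section RowCons.
Variables (R : realType) (n : nat).

Definition row_cons (zeta : R) (eta : 'rV[R]_n) : 'rV[R]_n.+1 :=
  \row_i if unlift ord0 i is Some j then eta ord0 j else zeta.

Lemma row_cons0 zeta eta : row_cons zeta eta ord0 ord0 = zeta.
Proof. by rewrite mxE unlift_none. Qed.

Lemma row_cons_lift zeta eta j : row_cons zeta eta ord0 (lift ord0 j) = eta ord0 j.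
Proof. by rewrite mxE liftK. Qed.

Lemma col'_row_cons zeta eta : col' ord0 (row_cons zeta eta) = eta.
Proof. by apply/rowP => j; rewrite !mxE liftK. Qed.

Lemma dist_intv_row_cons_le (k L zeta : R) (eta : 'rV[R]_n) : 0 <= L ->
  dist_int (k * zeta) <= L -> (forall j, dist_int (k * eta ord0 j) <= L) ->
  dist_intv (k *: row_cons zeta eta) <= L.
Proof.
move=> L0 hz he; apply: dist_intv_le => // i; rewrite mxE.
by case: (unliftP ord0 i) => [j|] ->; rewrite ?row_cons_lift ?row_cons0.
Qed.

Lemma dist_int_row_cons0 (k zeta : R) (eta : 'rV[R]_n) :
  dist_int (k * zeta) <= dist_intv (k *: row_cons zeta eta).
Proof. by have := dist_int_coord (k *: row_cons zeta eta) ord0; rewrite mxE row_cons0. Qed.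

Lemma dist_int_row_cons_lift (k zeta : R) (eta : 'rV[R]_n) j :
  dist_int (k * eta ord0 j) <= dist_intv (k *: row_cons zeta eta).
Proof.
by have := dist_int_coord (k *: row_cons zeta eta) (lift ord0 j); rewrite mxE row_cons_lift.
Qed.

End RowCons.

(** One scale of the construction.  The parameter [a] stands for the least integer with
    [h ^ n * (1 + 1/h) ^ m <= c ^ m * a ^ n]; the factor [1 + 1/h] absorbs the
    errors in the upper bounds and tends to 1 as [h] grows. *)
Section Stage.
Variables (R : realType) (n : nat) (c : R) (eta : 'rV[R]_n) (zeta : R).
Hypotheses (n_gt0 : (0 < n)%N) (c_itv : 0 < c <= 1).
Variables (h a : nat) (u : 'I_n -> int) (z : int) (theta : R).
Local Notation m := n.+1.
Let b := (a * h ^ n)%N.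
Let hR : R := h%:R.
Let aR : R := a%:R.
Let bR : R := b%:R.
Hypothesis h_big : 2 ^+ m <= hR * c ^+ m.
Hypothesis a_big : hR ^+ n * (1 + hR^-1) ^+ m <= c ^+ m * aR ^+ n.
Hypothesis a_min : c ^+ m * (aR - 1) ^+ n <= hR ^+ n * (1 + hR^-1) ^+ m.
Hypothesis u_coprime : forall j, coprimez (u j) h.
Hypothesis eta_close :
  `|eta - \row_j ((u j)%:~R / hR ^+ j.+1)| < (bR ^+ 4)^-1.
Hypothesis zetaE : zeta = z%:~R / hR ^+ n + bR^-1 + theta.
Hypothesis theta_itv : 0 <= theta <= (bR ^+ 4)^-1.

Let xi := row_cons zeta eta.

Let c_gt0 : 0 < c. Proof. by case/andP: c_itv. Qed.

Let cX_le1 k : c ^+ k <= 1.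
Proof. by case/andP: c_itv => c0 c1; apply: exprn_ile1 => //; exact: ltW. Qed.

Lemma stage_h_ge2 : 2 <= hR.
Proof.
have : 2 <= (2 : R) ^+ m by rewrite exprS ler_peMr ?ler0n ?exprn_ege1 ?ler1n.
move=> /le_trans /(_ h_big) /le_trans; apply.
by rewrite ler_piMr ?ler0n.
Qed.

Lemma stage_h_le_a : hR <= aR.
Proof.
rewrite -(@ler_pXn2r _ n)// ?nnegrE ?ler0n//.
apply: (@le_trans _ _ (hR ^+ n * (1 + hR^-1) ^+ m)).
  rewrite ler_peMr ?exprn_ge0 ?ler0n// exprn_ege1//.
  by rewrite lerDl invr_ge0 ler0n.
apply: (le_trans a_big); rewrite ler_piMl ?exprn_ge0 ?ler0n//.
Qed.

Let h_gt0 : 0 < hR.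
Proof. exact: lt_le_trans stage_h_ge2. Qed.

Let a_gt0 : 0 < aR.
Proof. exact: lt_le_trans stage_h_le_a. Qed.

Let bE : bR = aR * hR ^+ n.
Proof. by rewrite /bR /b natrM natrX. Qed.

Let hX_ge1 k : 1 <= hR ^+ k.
Proof. by apply: exprn_ege1; apply: le_trans stage_h_ge2; rewrite ler1n. Qed.

Let hX_gt0 k : 0 < hR ^+ k.
Proof. exact: exprn_gt0. Qed.

Lemma stage_a_le_b : aR <= bR.
Proof. by rewrite bE ler_peMr// ltW. Qed.

Lemma stage_b_ge2 : 2 <= bR.
Proof. exact: le_trans stage_h_ge2 (le_trans stage_h_le_a stage_a_le_b). Qed.

Let b_gt0 : 0 < bR.
Proof. exact: lt_le_trans stage_b_ge2. Qed.

Let eta_near j : `|eta ord0 j - (u j)%:~R / hR ^+ j.+1| <= (bR ^+ 4)^-1.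
Proof.
apply: ltW; apply: le_lt_trans eta_close.
by rewrite (le_trans _ (coord_le_norm _ j))// !mxE.
Qed.

Let err3 : bR * (bR ^+ 4)^-1 = (bR ^+ 3)^-1.
Proof. by field; rewrite gt_eqF. Qed.

(** All the approximation errors are at most [1 / b ^ 3], hence negligible
   compared with [1 / a]. *)
Let err3_le : (bR ^+ 3)^-1 <= (hR * aR)^-1.
Proof.
rewrite lef_pV2 ?posrE ?exprn_gt0 ?mulr_gt0// exprS.
have hb : hR <= bR := le_trans stage_h_le_a stage_a_le_b.
apply: ler_pM => //; try exact: ltW.
rewrite (le_trans stage_a_le_b)// expr2 ler_peMl ?(ltW b_gt0)//.
by apply: le_trans stage_b_ge2; rewrite ler1n.
Qed.

Let eta_mul_near (q : nat) j (p : int) :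
  q%:R * ((u j)%:~R / hR ^+ j.+1) = p%:~R :> R ->
  dist_int (q%:R * eta ord0 j) <= q%:R * (bR ^+ 4)^-1.
Proof.
move=> qp; apply: (le_trans (dist_int_le _ p)).
rewrite -qp -mulrBr normrM ger0_norm ?ler0n//.
by rewrite ler_wpM2l ?ler0n.
Qed.

Let hX_split (j : 'I_n) : hR ^+ n = hR ^+ (n - j.+1) * hR ^+ j.+1.
Proof. by rewrite -exprD subnK. Qed.

(** Modulo 1, [h ^ n * zeta] is [1 / a] up to a small error, and
    [h ^ n * (u_j / h ^ j.+1)] is an integer. *)
Lemma stage_dist_hn :
  dist_intv ((h ^ n)%:R *: xi) <= (1 + hR^-1) / aR.
Proof.
have E : hR ^+ n * (bR ^+ 4)^-1 <= hR^-1 / aR.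
  rewrite -invfM; apply: le_trans err3_le.
  rewrite -err3 ler_pM2r ?invr_gt0 ?exprn_gt0// bE ler_peMl ?(ltW (hX_gt0 n))//.
  by apply: le_trans stage_h_le_a; apply: le_trans stage_h_ge2; rewrite ler1n.
have E0 : 0 <= aR^-1 by rewrite invr_ge0 ltW.
rewrite mulrDl mul1r; apply: dist_intv_row_cons_le.
- by rewrite addr_ge0// mulr_ge0// invr_ge0 ltW.
- apply: (le_trans (dist_int_le _ z)).
  have -> : (h ^ n)%:R * zeta - z%:~R = aR^-1 + hR ^+ n * theta.
    rewrite natrX zetaE bE -/hR.
    by field; rewrite gt_eqF// gt_eqF.
  case/andP: theta_itv => t0 t1.
  have E1 : 0 <= hR ^+ n * theta by rewrite mulr_ge0// ltW.
  rewrite ger0_norm ?addr_ge0// lerD2l; apply: le_trans E.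
  by rewrite ler_wpM2l// ltW.
- move=> j; apply: le_trans (@eta_mul_near _ j (u j * h%:Z ^+ (n - j.+1)) _) _.
  + rewrite natrX -/hR rmorphM rmorphXn/= -[h%:~R]/hR (hX_split j).
    by field; rewrite gt_eqF.
  + by rewrite natrX (le_trans E)// lerDr.
Qed.

Lemma stage_dist_b : dist_intv (bR *: xi) <= (bR ^+ 3)^-1.
Proof.
rewrite -err3; apply: dist_intv_row_cons_le.
- by rewrite mulr_ge0 ?invr_ge0 ?exprn_ge0// ltW.
- apply: (le_trans (dist_int_le _ (a%:Z * z + 1))).
  have -> : bR * zeta - (a%:Z * z + 1)%:~R = bR * theta.
    rewrite zetaE rmorphD rmorphM/= -[a%:~R]/aR -[1%:~R]/(1 : R) bE.
    by field; rewrite !gt_eqF.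
  case/andP: theta_itv => t0 t1.
  by rewrite ger0_norm ?mulr_ge0 ?(ltW b_gt0)// ler_wpM2l// ltW.
- move=> j; apply: (@eta_mul_near b j (a%:Z * u j * h%:Z ^+ (n - j.+1))).
  rewrite -/bR bE !rmorphM rmorphXn/= -[h%:~R]/hR -[a%:~R]/aR (hX_split j).
  by field; rewrite gt_eqF.
Qed.

(** If [nu = mu * h ^ n] with [0 < mu < a], then [nu * zeta] is close to [mu / a]
    modulo 1.  Otherwise let [h ^ i] be the largest power of [h] dividing [nu], so
    that [i < n]: coordinate [i] of [nu *: eta] is close to [nu' * u_i / h], where
    [h] does not divide [nu' * u_i]. *)
Lemma stage_dist_lower nu : (0 < nu)%N -> (nu < b)%N ->
  (1 - hR^-1) / aR <= dist_intv (nu%:R *: xi).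
Proof.
move=> nu0 nub.
have nubR : nu%:R * (bR ^+ 4)^-1 <= (bR ^+ 3)^-1.
  by rewrite -err3 ler_pM2r ?invr_gt0 ?exprn_gt0// ler_nat ltnW.
have L3 : (1 - hR^-1) / aR <= aR^-1 - (bR ^+ 3)^-1.
  by rewrite mulrBl mul1r lerD2l lerN2 -invfM.
have [/dvdnP[mu nuE]|ndvd] := boolP (h ^ n %| nu)%N.
  apply: le_trans (dist_int_row_cons0 _ _ _).
  have mu0 : (0 < mu)%N by move: nu0; rewrite nuE; case: (mu).
  have mua : (mu < a)%N.
    by move: nub; rewrite nuE /b ltn_mul2r => /andP[].
  have mu1 : 1 <= mu%:R :> R by rewrite ler1n.
  have mua1 : mu%:R + 1 <= aR by rewrite natr1 ler_nat.
  case/andP: theta_itv => t0 t1.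
  have th0 : 0 <= nu%:R * theta by rewrite mulr_ge0.
  have th1 : nu%:R * theta <= (bR ^+ 3)^-1.
    by apply: le_trans nubR; rewrite ler_wpM2l.
  apply: (le_trans L3); apply: dist_int_ge => k.
  have -> : nu%:R * zeta - k%:~R =
      mu%:R / aR + nu%:R * theta - (k - mu%:Z * z)%:~R.
    rewrite zetaE rmorphB rmorphM/= -[mu%:~R]/(mu%:R) nuE natrM natrX -/hR bE.
    by field; rewrite !gt_eqF.
  move: (k - _) => t.
  have mu1' : aR^-1 <= mu%:R / aR by rewrite ler_peMl// invr_ge0 ltW.
  have mua' : mu%:R / aR <= 1 - aR^-1.
    have -> : 1 - aR^-1 = (aR - 1) / aR by field; rewrite gt_eqF.
    by rewrite ler_pM2r ?invr_gt0// lerBrDr.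
  have b3 : 0 <= (bR ^+ 3)^-1 by rewrite invr_ge0 exprn_ge0// ltW.
  have [t_le0|t_gt0] := lerP t 0.
    have : t%:~R <= 0 :> R by rewrite lerz0.
    by rewrite ler_normr => ?; apply/orP; left; lra.
  have : 1 <= t%:~R :> R by rewrite ler1z.
  by rewrite ler_normr => ?; apply/orP; right; lra.
have [i [hi nhi]] : exists i : 'I_n, (h ^ i %| nu)%N /\ ~~ (h ^ i.+1 %| nu)%N.
  apply: contrapT => noi; suff : (h ^ n %| nu)%N by rewrite (negbTE ndvd).
  suff H k : (k <= n)%N -> (h ^ k %| nu)%N by exact: H.
  elim: k => [|k IHk] kn; first by rewrite dvd1n.
  apply: contrapT => nk; apply: noi; exists (Ordinal kn) => /=.
  by split; [exact/IHk/ltnW|exact/negP].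
case/dvdnP: hi => nu' nuE.
have nh : ~~ (h %| nu')%N.
  apply: contra nhi => hnu; rewrite nuE expnS; exact: dvdn_mul.
apply: le_trans (dist_int_row_cons_lift _ _ _ i).
apply: dist_int_ge => k.
have E : nu%:R * ((u i)%:~R / hR ^+ i.+1) - k%:~R =
    (nu'%:Z * u i - k * h%:Z)%:~R / hR.
  rewrite rmorphB !rmorphM/= -[nu'%:~R]/(nu'%:R) -[h%:~R]/hR nuE natrM natrX -/hR.
  by rewrite exprS; field; rewrite !gt_eqF.
have ne0 : nu'%:Z * u i - k * h%:Z != 0.
  apply: contra nh => /eqP/subr0_eq e0.
  have : (h%:Z %| nu'%:Z * u i)%Z by rewrite e0 dvdz_mull.
  by rewrite Gauss_dvdzl// coprimez_sym.
have far : aR^-1 <= `|nu%:R * ((u i)%:~R / hR ^+ i.+1) - k%:~R|.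
  rewrite E normrM normfV (gtr0_norm h_gt0).
  apply: (@le_trans _ _ hR^-1); first by rewrite lef_pV2// stage_h_le_a.
  by rewrite ler_peMl ?invr_ge0 ?(ltW h_gt0)// int_norm_ge1.
have near_ : `|nu%:R * eta ord0 i - nu%:R * ((u i)%:~R / hR ^+ i.+1)| <= (bR ^+ 3)^-1.
  rewrite -mulrBr normrM ger0_norm ?ler0n//.
  by apply: le_trans nubR; rewrite ler_wpM2l.
apply: (le_trans L3); rewrite lerBlDr; apply: (le_trans far).
apply: (le_trans (ler_distD (nu%:R * eta ord0 i) _ _)).
by rewrite addrC lerD2l distrC.
Qed.


Let inv_b_le_c : bR^-1 <= c.
Proof.
have hc1 : 1 <= hR * c.
  apply: (@le_trans _ _ (2 ^+ m)); first by rewrite exprn_ege1// ler1n.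
  apply: (le_trans h_big); rewrite ler_pM2l// exprS.
  by rewrite -[leRHS]mulr1 ler_pM2l.
rewrite -[bR^-1]mul1r ler_pdivrMr// mulrC; apply: (le_trans hc1).
by rewrite ler_pM2r// (le_trans stage_h_le_a)// stage_a_le_b.
Qed.

Let psi_expr_le Q d B : 1 <= Q -> Q <= B -> psi xi Q <= d ->
  d ^+ m * B <= c ^+ m -> psi xi Q ^+ m * Q <= c ^+ m.
Proof.
move=> Q1 QB pd; apply: le_trans; have p0 := psi_ge0 xi Q1.
have Q0 : 0 <= Q := le_trans ler01 Q1.
apply: ler_pM => //; first exact: exprn_ge0.
by apply: lerXn2r => //; rewrite nnegrE// (le_trans p0).
Qed.

(** The choice of [a] makes [1 / a] smaller than [c * b `^ (- 1 / m)], and the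
    right-hand side of the bound on psi is smallest at [Q = b]. *)
Lemma stage_psi_hn Q : (h ^ n)%:R <= Q -> Q <= bR ->
  psi xi Q ^+ m * Q <= c ^+ m.
Proof.
move=> hQ Qb; have Q1 : 1 <= Q by apply: le_trans hQ; rewrite natrX; exact: hX_ge1.
apply: (psi_expr_le Q1 Qb).
  apply: (le_trans (psi_le _ _ hQ)); last exact: stage_dist_hn.
  by rewrite -(ltr0n R) natrX.
have -> : ((1 + hR^-1) / aR) ^+ m * bR = hR ^+ n * (1 + hR^-1) ^+ m / aR ^+ n.
  rewrite bE expr_div_n [aR ^+ m]exprS.
  by field; rewrite !gt_eqF ?exprn_gt0.
by rewrite ler_pdivrMr ?exprn_gt0.
Qed.

Lemma stage_psi_b Q : bR <= Q -> Q <= bR ^+ (2 * m) ->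
  psi xi Q ^+ m * Q <= c ^+ m.
Proof.
move=> bQ Qb; have Q1 : 1 <= Q.
  by apply: le_trans bQ; apply: le_trans stage_b_ge2; rewrite ler1n.
apply: (psi_expr_le Q1 Qb).
  by apply: (le_trans (psi_le _ _ bQ)); [rewrite -(ltr0n R)|exact: stage_dist_b].
rewrite exprM -exprMn.
have -> : (bR ^+ 3)^-1 * bR ^+ 2 = bR^-1 by field; rewrite gt_eqF.
by apply: lerXn2r => //; rewrite nnegrE ltW ?invr_gt0.
Qed.

(** Along [Q = b] the normalized psi tends to 0: this excludes badly
    approximable vectors. *)
Lemma stage_psi_at_b : psi xi bR ^+ m * bR <= bR^-1.
Proof.
have b1 : 1 <= bR by apply: le_trans stage_b_ge2; rewrite ler1n.
have p0 := psi_ge0 xi b1.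
have pb : psi xi bR <= (bR ^+ 3)^-1.
  by apply: (le_trans (psi_le _ _ (lexx _))); [rewrite -(ltr0n R)|exact: stage_dist_b].
have b3 : (bR ^+ 3)^-1 <= 1 by rewrite invf_le1 ?exprn_gt0// exprn_ege1.
have pm : psi xi bR ^+ m <= (bR ^+ 3)^-1.
  apply: (@le_trans _ _ ((bR ^+ 3)^-1 ^+ m)).
    by apply: lerXn2r => //; rewrite nnegrE// (le_trans p0).
  rewrite exprS ler_piMr ?exprn_ile1//; rewrite ?(le_trans p0)//.
apply: (@le_trans _ _ ((bR ^+ 3)^-1 * bR)); first by rewrite ler_pM2r.
rewrite -[leRHS]mul1r -(@divff _ (bR ^+ 2)) ?gt_eqF ?exprn_gt0//.
have -> : (bR ^+ 3)^-1 * bR = (bR ^+ 2)^-1 by field; rewrite gt_eqF.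
have -> : bR ^+ 2 / bR ^+ 2 / bR = bR^-1 by field; rewrite gt_eqF.
by rewrite lef_pV2 ?posrE ?exprn_gt0// expr2 ler_peMl// ltW.
Qed.

(** Use [nu * b], where [nu] is given by Dirichlet's theorem for [b *: eta] and
    [N = Q / b].  The coordinates of [eta] contribute [d] with [d ^ n * N] bounded,
    of smaller order than required once [Q] exceeds a power of [b]; [zeta]
    contributes at most [Q * theta], of order at most [1 / h'] at the end of the
    range. *)
Lemma stage_psi_gap (h' a' : nat) Q : 2 ^+ m <= h'%:R * c ^+ m ->
  (h' <= a')%N -> theta <= 2 / (a' * h' ^ n)%:R ->
  bR ^+ (2 * m) <= Q -> Q <= (h' ^ n)%:R -> psi xi Q ^+ m * Q <= c ^+ m.
Proof.
move=> h'_big ha' th' bQ Qh'.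
have b1 : 1 <= bR by apply: le_trans stage_b_ge2; rewrite ler1n.
have Q1 : 1 <= Q by apply: le_trans bQ; rewrite exprn_ege1.
have Q0 : 0 < Q := lt_le_trans ltr01 Q1.
have h'0 : (0 : R) < h'%:R.
  have : 0 < h'%:R * c ^+ m by apply: lt_le_trans h'_big; rewrite exprn_gt0.
  by rewrite pmulr_lgt0 ?exprn_gt0.
have a'0 : (0 : R) < a'%:R by apply: lt_le_trans h'0 _; rewrite ler_nat.
have bQ1 : bR <= Q by apply: le_trans bQ; rewrite exprS ler_peMr ?exprn_ege1// ltW.
pose N := Num.truncn (Q / bR).
have /andP[NQ QN] : N%:R <= Q / bR < N.+1%:R.
  by apply: truncn_itv; rewrite divr_ge0// ltW.
have N0 : (0 < N)%N by rewrite truncn_gt0 ler_pdivlMr// mul1r.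
have [nu [nu0 nuN dnu]] := weak_dirichlet (bR *: eta) n_gt0 N0.
set d := dist_intv _ in dnu.
have d0 : 0 <= d by exact: dist_intv_ge0.
have nubQ : (nu * b)%:R <= Q.
  rewrite natrM -ler_pdivlMr//; apply: le_trans NQ.
  by rewrite ler_nat.
have e_ge0 : 0 <= (nu * b)%:R * theta by case/andP: theta_itv => t0 _; rewrite mulr_ge0.
have pmax : psi xi Q <= Num.max d ((nu * b)%:R * theta).
  apply: (le_trans (psi_le _ _ nubQ)).
    by rewrite muln_gt0 nu0 -(ltr0n R).
  apply: dist_intv_row_cons_le; first by rewrite le_max d0.
  - rewrite le_max; apply/orP; right.
    apply: (le_trans (dist_int_le _ (nu%:Z * (a%:Z * z + 1)))).
    have -> : (nu * b)%:R * zeta - (nu%:Z * (a%:Z * z + 1))%:~R = (nu * b)%:R * theta.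
      rewrite zetaE natrM intrM intrD intrM.
      rewrite -[a%:~R]/aR -[1%:~R]/(1 : R) -[nu%:~R]/(nu%:R : R) -/bR bE.
      by field; rewrite !gt_eqF.
    by rewrite ger0_norm.
  - move=> j; rewrite le_max; apply/orP; left.
    have := dist_int_coord (nu%:R *: (bR *: eta)) j.
    by rewrite !mxE mulrA -natrM.
have Q_ge0 := ltW Q0.
have dQ : d ^+ m * Q <= c ^+ m.
  have Q2 : Q <= 2 * N%:R * bR.
    rewrite -ler_pdivrMr//; apply: (le_trans (ltW QN)).
    by rewrite mulr_natl mulr2n -natr1 lerD2l ler1n.
  have dQn : d ^+ n * Q <= 2 ^+ m * bR.
    apply: (@le_trans _ _ (d ^+ n * (2 * N%:R * bR))).
      by rewrite ler_wpM2l// exprn_ge0.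
    have -> : d ^+ n * (2 * N%:R * bR) = (d ^+ n * N%:R) * (2 * bR) by ring.
    rewrite (exprSr 2) -[leRHS]mulrA ler_wpM2r//.
    by rewrite mulr_ge0// ltW.
  (* Raise to the power [n] to use [dQn]: [(d ^ m * Q) ^ n * Q = (d ^ n * Q) ^ m]. *)
  rewrite -(@ler_pXn2r _ n)// ?nnegrE ?mulr_ge0 ?exprn_ge0// ?(ltW c_gt0)//.
  rewrite exprMn exprAC.
  rewrite -(ler_pM2r Q0).
  have -> : (d ^+ n) ^+ m * Q ^+ n * Q = (d ^+ n * Q) ^+ m.
    by rewrite exprMn [in RHS](exprSr Q) mulrA.
  apply: (@le_trans _ _ ((2 ^+ m * bR) ^+ m)).
    by apply: lerXn2r => //; rewrite nnegrE mulr_ge0 ?exprn_ge0 ?(ltW b_gt0).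
  apply: (@le_trans _ _ ((c ^+ n * bR ^+ 2) ^+ m)).
    apply: lerXn2r; rewrite ?nnegrE ?mulr_ge0 ?exprn_ge0 ?(ltW b_gt0) ?(ltW c_gt0)//.
    rewrite expr2 mulrA ler_pM2r//; apply: (le_trans h_big); rewrite mulrC.
    apply: ler_pM; rewrite ?exprn_ge0 ?(ltW c_gt0) ?(ltW h_gt0)//.
      by rewrite exprS ler_piMl ?exprn_ge0 ?(ltW c_gt0)//; case/andP: c_itv.
    exact: le_trans stage_h_le_a stage_a_le_b.
  rewrite exprMn -!exprM [(m * n)%N]mulnC.
  by rewrite ler_wpM2l ?exprn_ge0 ?(ltW c_gt0).
have eQ : ((nu * b)%:R * theta) ^+ m * Q <= c ^+ m.
  have e_le : (nu * b)%:R * theta <= 2 / a'%:R.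
    apply: (@le_trans _ _ ((h' ^ n)%:R * (2 / (a' * h' ^ n)%:R))).
      apply: ler_pM => //; first by case/andP: theta_itv.
      exact: le_trans nubQ Qh'.
    rewrite natrM le_eqVlt; apply/orP; left; apply/eqP.
    by field; rewrite !natrX !gt_eqF ?exprn_gt0.
  have e_le' : (nu * b)%:R * theta <= 2 / h'%:R.
    apply: (le_trans e_le); rewrite ler_pM2l// lef_pV2//.
    by rewrite ler_nat.
  apply: (@le_trans _ _ ((2 / h'%:R) ^+ m * (h' ^ n)%:R)).
    apply: ler_pM => //; first exact: exprn_ge0.
    by apply: lerXn2r => //; rewrite nnegrE divr_ge0// ltW.
  have -> : (2 / h'%:R) ^+ m * (h' ^ n)%:R = 2 ^+ m / h'%:R :> R.
    rewrite natrX expr_div_n [h'%:R ^+ m]exprS.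
    by field; rewrite gt_eqF// gt_eqF ?exprn_gt0.
  by rewrite ler_pdivrMr// mulrC.
apply: (psi_expr_le Q1 (lexx _) pmax).
by case: (leP d ((nu * b)%:R * theta)).
Qed.

(** Evaluate at [Q = (1 - 1/h) * b], just below [b], where psi is still at least
    [(1 - 1/h) / a]; the minimality of [a] makes [1 / a] close to
    [c * b `^ (- 1 / m)]. *)
Lemma stage_sharp c' Q0 : Q0 <= hR ->
  (forall Q, Q0 <= Q -> psi xi Q ^+ m * Q <= c' ^+ m) ->
  c ^+ m * (1 - hR^-1) ^+ (n + (m.+1 + m)) <= c' ^+ m.
Proof.
move=> Q0h small; set x := hR^-1; pose Q := bR * (1 - x).
have x0 : 0 < x by rewrite invr_gt0.
have x2 : x <= 2^-1 by rewrite lef_pV2 ?posrE ?stage_h_ge2.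
have x1 : 0 < 1 - x by lra.
have hQ : hR <= Q.
  have hhb : hR * hR <= bR.
    rewrite bE; apply: ler_pM; rewrite ?(ltW h_gt0) ?stage_h_le_a//.
    by rewrite -[leLHS]expr1 ler_weXn2l// -[hR]expr1 hX_ge1.
  apply: (@le_trans _ _ (hR * hR * (1 - x))); last by rewrite ler_pM2r.
  have -> : hR * hR * (1 - x) = hR * (hR - 1) by rewrite /x; field; rewrite gt_eqF.
  rewrite ler_peMr ?(ltW h_gt0)//; have := stage_h_ge2; lra.
have Q1 : 1 <= Q by apply: le_trans hQ; apply: le_trans stage_h_ge2; rewrite ler1n.
have Qb : Q < bR by rewrite /Q -[ltRHS]mulr1 ltr_pM2l//; lra.
have low : (1 - x) / aR <= psi xi Q.
  apply: psi_ge => // q q0 qQ; apply: stage_dist_lower => //.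
  by rewrite -(ltr_nat R) (le_lt_trans qQ).
have := small Q (le_trans Q0h hQ).
have L0 : 0 <= (1 - x) / aR by rewrite divr_ge0 ?(ltW x1) ?(ltW a_gt0).
have : ((1 - x) / aR) ^+ m * Q <= psi xi Q ^+ m * Q.
  rewrite ler_pM2r ?(lt_le_trans ltr01)//.
  by apply: lerXn2r; rewrite // nnegrE// (le_trans L0).
move=> /le_trans H /H{H}.
have -> : ((1 - x) / aR) ^+ m * Q = (1 - x) ^+ m.+1 * (hR ^+ n / aR ^+ n).
  rewrite /Q bE expr_div_n [aR ^+ m]exprS [in RHS]exprS.
  by field; rewrite !gt_eqF ?exprn_gt0.
move=> upper.
have lower : c ^+ m * (1 - x) ^+ n <= hR ^+ n / aR ^+ n * (1 + x) ^+ m.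
  rewrite mulrAC ler_pdivlMr ?exprn_gt0//; apply: le_trans a_min.
  rewrite -mulrA -exprMn ler_wpM2l ?exprn_ge0 ?(ltW c_gt0)//.
  have a1 : aR * x >= 1 by rewrite ler_pdivlMr// mul1r stage_h_le_a.
  apply: lerXn2r; rewrite ?nnegrE ?mulr_ge0 ?(ltW x1) ?(ltW a_gt0)//.
    have := stage_h_ge2; have := stage_h_le_a; lra.
  by rewrite mulrBl mul1r mulrC; lra.
set g := hR ^+ n / aR ^+ n in upper lower.
have xm0 : 0 < (1 - x) ^+ m by rewrite exprn_gt0.
have -> : c ^+ m * (1 - x) ^+ (n + (m.+1 + m)) =
    c ^+ m * (1 - x) ^+ n * ((1 - x) ^+ m.+1 * (1 - x) ^+ m).
  by rewrite -mulrA -!exprD.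
apply: (@le_trans _ _ (g * (1 + x) ^+ m * ((1 - x) ^+ m.+1 * (1 - x) ^+ m))).
  by rewrite ler_pM2r// mulr_gt0// exprn_gt0.
have -> : g * (1 + x) ^+ m * ((1 - x) ^+ m.+1 * (1 - x) ^+ m) =
    ((1 - x) ^+ m.+1 * g) * ((1 + x) * (1 - x)) ^+ m by rewrite exprMn; ring.
apply: le_trans upper; rewrite ler_piMr//.
  by rewrite mulr_ge0 ?divr_ge0 ?exprn_ge0 ?(ltW x1) ?(ltW a_gt0) ?(ltW h_gt0).
apply: exprn_ile1; nra.
Qed.

End Stage.

(** * Vectors with a prescribed Dirichlet constant *)

Section Chain.
Variables (R : realType) (n : nat) (h a : nat -> nat).
Hypothesis n_gt0 : (0 < n)%N.
Let b k := (a k * h k ^ n)%N.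
Hypothesis b_gt0 : forall k, (0 < b k)%N.
Hypothesis h_le_b : forall k, (h k <= b k)%N.
Hypothesis b_lt_h : forall k, (2 * b k ^ 4 <= h k.+1)%N.
Hypothesis b_dvd_h : forall k, (b k %| h k.+1)%N.

Let S k : R := \sum_(i < k) (b i)%:R^-1.

Let bR_gt0 k : (0 : R) < (b k)%:R.
Proof. by rewrite ltr0n. Qed.

Let b_growth k : (2 * b k ^ 4 <= b k.+1)%N.
Proof. exact: leq_trans (b_lt_h k) (h_le_b _). Qed.

Let S_head k : exists z : int, S k = z%:~R / (h k)%:R ^+ n.
Proof.
elim: k => [|k [z Sz]]; first by exists 0; rewrite /S big_ord0 mul0r.
have /dvdnP[w hw] : (b k %| h k.+1 ^ n)%N.
  by rewrite -(prednK n_gt0) expnS dvdn_mulr.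
exists ((a k)%:Z * z * w%:Z + w%:Z).
have hk : (0 : R) < (h k)%:R ^+ n.
  by rewrite -natrX ltr0n; move: (b_gt0 k); rewrite muln_gt0 => /andP[].
have ak : (0 : R) < (a k)%:R.
  by rewrite ltr0n; move: (b_gt0 k); rewrite muln_gt0 => /andP[].
have w0 : (0 : R) < w%:R.
  have : (0 < h k.+1 ^ n)%N.
    by rewrite expn_gt0 (leq_trans _ (b_lt_h k))// muln_gt0 expn_gt0 b_gt0.
  by rewrite hw muln_gt0 ltr0n => /andP[].
rewrite /S big_ord_recr/= -/(S k) Sz intrD !intrM -(natrX _ (h k.+1) n) hw /b.
rewrite -[(a k)%:~R]/((a k)%:R : R) -[w%:~R]/(w%:R : R) !natrM natrX.
by field; rewrite !gt_eqF.
Qed.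

(** The number [zeta] is the sum of the series of the [1 / b k].  Since [b i]
    divides [h k] for [i < k], the partial sum before [1 / b k] has denominator
    [h k ^ n]; the fast growth bounds the tail [theta k] by twice its first
    term. *)
Lemma chain_sum_exists : exists (zeta : R) (z : nat -> int) (theta : nat -> R),
  forall k, [/\ zeta = (z k)%:~R / (h k)%:R ^+ n + (b k)%:R^-1 + theta k,
    0 <= theta k <= ((b k)%:R ^+ 4)^-1 & theta k <= 2 / (b k.+1)%:R].
Proof.
have invb k : 2 * (b k.+1)%:R^-1 <= ((b k)%:R ^+ 4)^-1 :> R.
  rewrite ler_pdivrMr// mulrC ler_pdivlMr ?exprn_gt0//.
  by rewrite -natrX -natrM ler_nat.
have invb1 k : 2 * (b k.+1)%:R^-1 <= (b k)%:R^-1 :> R.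
  apply: (le_trans (invb k)); rewrite lef_pV2 ?posrE ?exprn_gt0//.
  by rewrite -natrX ler_nat -[leqLHS]expn1 leq_pexp2l.
have S_le i j : (i <= j)%N -> S i <= S j.
  move=> /subnK <-; elim: (j - i)%N => // k IHk.
  by rewrite addSn /S big_ord_recr/= -/(S _) (le_trans IHk)// lerDl invr_ge0.
pose V k := S k + 2 * (b k)%:R^-1.
have V_le i j : (i <= j)%N -> V j <= V i.
  move=> /subnK <-; elim: (j - i)%N => // k IHk; apply: le_trans IHk.
  rewrite addSn /V /S big_ord_recr/= -/(S _).
  have := invb1 (k + i)%N; set x := _^-1; set y := _^-1; lra.
have SV i j : S i <= V j.
  apply: (@le_trans _ _ (S (maxn i j))); first by rewrite S_le// leq_maxl.
  apply: (@le_trans _ _ (V (maxn i j))); last by rewrite V_le// leq_maxr.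
  by rewrite /V lerDl mulr_ge0// invr_ge0.
pose zeta := sup (range S).
have zeta_ge k : S k <= zeta.
  by apply: ub_le_sup; [exists (V 0%N) => _ [i _ <-]|exists k].
have zeta_le k : zeta <= V k.
  by apply: ge_sup; [exists (S 0%N), 0%N|move=> _ [i _ <-]].
have [z zP] := choice S_head.
exists zeta, z, (fun k => zeta - S k.+1) => k.
have th : zeta - S k.+1 <= 2 / (b k.+1)%:R.
  by rewrite lerBlDl; exact: zeta_le.
split=> //; last by rewrite subr_ge0 zeta_ge/= (le_trans th).
have Sk : S k.+1 = S k + (b k)%:R^-1 by rewrite /S big_ord_recr.
by rewrite -zP Sk; ring.
Qed.

End Chain.

Section Existence.
Variables (R : realType) (n : nat) (c : R).
Hypotheses (n_gt0 : (0 < n)%N) (c_itv : 0 < c <= 1).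
Local Notation m := n.+1.

Lemma one_sub_expr_ge (x : R) p : 0 <= x <= 1 -> 1 - p%:R * x <= (1 - x) ^+ p.
Proof.
case/andP=> x0 x1; elim: p => [|p IHp]; first by rewrite mul0r subr0.
have x10 : 0 <= 1 - x by rewrite subr_ge0.
rewrite exprS -natr1; apply: le_trans (ler_wpM2l x10 IHp).
have : 0 <= p%:R * x * x by rewrite !mulr_ge0.
lra.
Qed.

Lemma scale_exists : {a : nat -> nat | forall h, (0 < h)%N ->
  [/\ (0 < a h)%N,
    h%:R ^+ n * (1 + h%:R^-1) ^+ m <= c ^+ m * (a h)%:R ^+ n :> R &
    c ^+ m * ((a h)%:R - 1) ^+ n <= h%:R ^+ n * (1 + h%:R^-1) ^+ m :> R]}.
Proof.
have c0 : 0 < c by case/andP: c_itv.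
have ex h : exists a : nat, h%:R ^+ n * (1 + h%:R^-1) ^+ m <= c ^+ m * a%:R ^+ n :> R.
  set y := _ * _; exists (Num.bound (y / c ^+ m)).
  rewrite mulrC -ler_pdivrMr ?exprn_gt0//.
  have y0 : 0 <= y / c ^+ m.
    by rewrite divr_ge0 ?mulr_ge0 ?exprn_ge0 ?addr_ge0 ?invr_ge0// ltW.
  have := archi_boundP y0; case: (Num.bound _) => [|k]; first by rewrite ltNge y0.
  move=> /ltW /le_trans; apply.
  case: (n) n_gt0 => // n' _; rewrite exprS ler_peMr// exprn_ege1// ler1n//.
exists (fun h => ex_minn (ex h)) => h h0.
case: ex_minnP => a aP amin.
have a0 : (0 < a)%N.
  case: a aP {amin} => // aP; exfalso; move: aP.
  rewrite expr0n gtn_eqF// mulr0 leNgt.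
  by rewrite mulr_gt0 ?exprn_gt0 ?addr_gt0 ?invr_gt0 ?ltr0n.
split=> //; rewrite leNgt; apply/negP => /ltW.
have -> : a%:R - 1 = a.-1%:R :> R by rewrite -{1}(prednK a0) -natr1 addrK.
by move=> /amin; rewrite leqNgt; case: (a) a0 => //= k _; rewrite ltnSn.
Qed.


(** The chain of scales is obtained by iterating the approximation property of
    [eta], at each step with [2 * b ^ 4] as lower bound and divisor of the next
    [h].  The intervals from [h_k ^ n] to [h_{k+1} ^ n] cover all large [Q], which
    gives the upper bound; the two other properties come from arbitrarily large scales. *)
Lemma exact_vector_exists (eta : 'rV[R]_n) (a : nat -> nat) :
  (forall h, (0 < h)%N ->
  [/\ (0 < a h)%N,
    h%:R ^+ n * (1 + h%:R^-1) ^+ m <= c ^+ m * (a h)%:R ^+ n :> R &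
    c ^+ m * ((a h)%:R - 1) ^+ n <= h%:R ^+ n * (1 + h%:R^-1) ^+ m :> R]) ->
  (forall B, ladder_approx_beyond
     (fun h => ((a h * h ^ n)%:R ^+ 4)^-1) B eta) ->
  exists zeta : R, let xi := row_cons zeta eta in
  [/\ exists2 Q0 : R, 1 <= Q0 &
        forall Q, Q0 <= Q -> psi xi Q ^+ m * Q <= c ^+ m,
      forall c' Q0 : R, 0 <= c' ->
        (forall Q, Q0 <= Q -> psi xi Q ^+ m * Q <= c' ^+ m) -> c <= c' &
      forall e Q0 : R, 0 < e ->
        exists2 Q, Q0 <= Q /\ 1 <= Q & psi xi Q ^+ m * Q <= e].
Proof.
have /andP[c0 c1] := c_itv.
move=> aP etaP; pose b h := (a h * h ^ n)%N.
have [H HP] := choice etaP.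
have [H0 hH0] : exists H0 : nat, forall h, (H0 <= h)%N -> 2 ^+ m <= h%:R * c ^+ m.
  exists (Num.bound (2 ^+ m / c ^+ m)) => h hh; rewrite -ler_pdivrMr ?exprn_gt0//.
  apply: (le_trans (ltW (archi_boundP _))).
    by rewrite divr_ge0 ?exprn_ge0// ltW.
  by rewrite ler_nat.
pose nxt h := H (2 * b h ^ 4).-1.
pose hs k := iter k nxt (H H0).
pose as_ k := a (hs k); pose bs k := (as_ k * hs k ^ n)%N.
have hs_gt0 k : (0 < hs k)%N.
  by case: k => [|k]; [case: (HP H0)|case: (HP (2 * b (hs k) ^ 4).-1)] => /(leq_ltn_trans (leq0n _)).
have as_gt0 k : (0 < as_ k)%N by case: (aP _ (hs_gt0 k)).
have bs_gt0 k : (0 < bs k)%N by rewrite muln_gt0 as_gt0 expn_gt0 hs_gt0.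
have b4 k : (2 * bs k ^ 4).-1.+1 = (2 * bs k ^ 4)%N.
  by rewrite prednK// muln_gt0 expn_gt0 bs_gt0.
have b_lt_h k : (2 * bs k ^ 4 <= hs k.+1)%N.
  by case: (HP (2 * bs k ^ 4).-1) => + _ _; rewrite b4.
have b_dvd_h k : (bs k %| hs k.+1)%N.
  case: (HP (2 * bs k ^ 4).-1) => _ + _; rewrite b4; apply: dvdn_trans.
  by rewrite dvdn_mull// -{1}(expn1 (bs k)) dvdn_exp2l.
have approx k : ladder_approx (fun h => ((a h * h ^ n)%:R ^+ 4)^-1) (hs k) eta.
  by case: k => [|k]; [case: (HP H0)|case: (HP (2 * b (hs k) ^ 4).-1)].
have a_big k := let: And3 _ x _ := aP _ (hs_gt0 k) in x.
have a_min k := let: And3 _ _ x := aP _ (hs_gt0 k) in x.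
have h_le_a k : (hs k <= as_ k)%N.
  by rewrite -(ler_nat R); exact: stage_h_le_a n_gt0 c_itv _ _ (a_big k).
have h_le_b k : (hs k <= bs k)%N.
  by rewrite (leq_trans (h_le_a k))// leq_pmulr// expn_gt0 hs_gt0.
have b_le_h k : (bs k < hs k.+1)%N.
  apply: leq_trans (b_lt_h k); rewrite (@leq_ltn_trans (bs k ^ 4))//.
    by rewrite -[leqLHS]expn1 leq_pexp2l.
  by rewrite ltn_Pmull// expn_gt0 bs_gt0.
have hs_ge k : (H0 + k <= hs k)%N.
  elim: k => [|k IHk]; first by rewrite addn0; case: (HP H0) => /ltnW.
  by rewrite addnS (leq_ltn_trans IHk)// (leq_ltn_trans (h_le_b k)).
have h_big k : 2 ^+ m <= (hs k)%:R * c ^+ m.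
  by apply: hH0; rewrite (leq_trans _ (hs_ge k))// leq_addr.
have [zeta [z [theta chain]]] := chain_sum_exists R n_gt0 bs_gt0 h_le_b b_lt_h b_dvd_h.
have zetaE k := let: And3 x _ _ := chain k in x.
have theta_itv k := let: And3 _ x _ := chain k in x.
have theta_le k := let: And3 _ _ x := chain k in x.
have hs_unbounded (x : R) p : exists2 k, (p <= k)%N & x <= (hs k)%:R.
  exists (maxn p (Num.bound `|x|)); first exact: leq_maxl.
  rewrite (le_trans (ler_norm x))//.
  rewrite (le_trans (ltW (archi_boundP (normr_ge0 x))))// ler_nat.
  by rewrite (leq_trans _ (hs_ge _))// (leq_trans (leq_maxr p _))// leq_addl.
exists zeta => xi; split.
- exists (hs 0 ^ n)%:R; first by rewrite ler1n expn_gt0 hs_gt0.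
  move=> Q hQ.
  (* The scale [k] to which [Q] belongs. *)
  have exk : exists k, Q < (hs k.+1 ^ n)%:R.
    have [k _ Qk] := hs_unbounded Q 0%N; exists k; apply: (le_lt_trans Qk).
    rewrite ltr_nat (leq_trans (leq_ltn_trans (h_le_b k) (b_le_h k)))//.
    by rewrite -[leqLHS]expn1 leq_pexp2l.
  case: (ex_minnP exk) => k Qlt kmin.
  have hkQ : (hs k ^ n)%:R <= Q.
    case: k Qlt kmin => // k _ kmin; rewrite leNgt; apply/negP => /kmin.
    by rewrite ltnn.
  have [u [uc ue]] := approx k.
  have [Qb|bQ] := leP Q (bs k)%:R.
    exact: (stage_psi_hn n_gt0 c_itv (h_big k) (a_big k) ue (zetaE k)).
  have [Qb|bQ'] := leP Q ((bs k)%:R ^+ (2 * m)).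
    exact: (stage_psi_b n_gt0 c_itv (h_big k) (a_big k) ue (zetaE k) (theta_itv k) (ltW bQ)).
  exact: (stage_psi_gap eta n_gt0 c_itv (h_big k) (a_big k) (zetaE k) (theta_itv k)
    (h_big k.+1) (h_le_a k.+1) (theta_le k) (ltW bQ') (ltW Qlt)).
- move=> c' Q0 c'0 small.
  rewrite -(@ler_pXn2r _ m)// ?nnegrE//; last exact: ltW.
  set p := (n + (m.+1 + m))%N.
  have step k : Q0 <= (hs k)%:R -> c ^+ m * (1 - p%:R * (hs k)%:R^-1) <= c' ^+ m.
    move=> Q0h; have [u [uc ue]] := approx k.
    apply: le_trans (stage_sharp n_gt0 c_itv (h_big k) (a_big k) (a_min k) uc ue
      (zetaE k) (theta_itv k) Q0h small).
    rewrite ler_wpM2l ?exprn_ge0 ?(ltW c0)// one_sub_expr_ge//.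
    by rewrite invr_ge0 ler0n/= invf_le1 ?ltr0n// ler1n.
  rewrite leNgt; apply/negP => lt_c.
  pose d := c ^+ m - c' ^+ m; have d0 : 0 < d by rewrite subr_gt0.
  have [k _] := hs_unbounded (Num.max Q0 ((p%:R * c ^+ m) / d + 1)) 0%N.
  rewrite ge_max => /andP[/step st hk].
  have : p%:R * c ^+ m / (hs k)%:R < d.
    rewrite ltr_pdivrMr ?ltr0n// -ltr_pdivrMl// mulrC.
    by rewrite (lt_le_trans _ hk)// ltrDl.
  have : c ^+ m * (1 - p%:R * (hs k)%:R^-1) = c ^+ m - p%:R * c ^+ m / (hs k)%:R by ring.
  by move=> E; move: st; rewrite E /d; set t := _ / _; lra.
- move=> e Q0 e0; have [k _] := hs_unbounded (Num.max Q0 e^-1) 0%N.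
  rewrite ge_max => /andP[Q0k ek]; have [u [uc ue]] := approx k.
  have hb : (hs k)%:R <= (bs k)%:R :> R by rewrite ler_nat.
  exists (bs k)%:R; first by rewrite (le_trans Q0k)// ler1n bs_gt0.
  apply: le_trans (stage_psi_at_b n_gt0 c_itv (h_big k) (a_big k) ue (zetaE k) (theta_itv k)) _.
  by rewrite invf_ple ?posrE ?ltr0n ?bs_gt0// (le_trans ek).
Qed.

End Existence.

(** * The exact sets and their packing dimension *)

Section ExactSet.
Variable R : realType.

Lemma Di_exprP m (c : R) (xi : 'rV[R]_m) : (0 < m)%N -> 0 <= c ->
  Di m c xi <-> exists2 Q0 : R, 1 <= Q0 &
    forall Q, Q0 <= Q -> psi xi Q ^+ m * Q <= c ^+ m.
Proof.
move=> m0 c0; split=> -[Q0 Q01 H]; exists Q0 => // Q Q0Q.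
  have Q1 := le_trans Q01 Q0Q; have Q0' := lt_le_trans ltr01 Q1.
  by rewrite -le_mul_powRN// ?psi_ge0// H.
have Q1 := le_trans Q01 Q0Q; have Q0' := lt_le_trans ltr01 Q1.
by rewrite le_mul_powRN// ?psi_ge0// H.
Qed.

Lemma Di_lt0 m (c : R) (xi : 'rV[R]_m) : c < 0 -> ~ Di m c xi.
Proof.
move=> c0 [Q0 Q01 /(_ Q0 (lexx _))]; apply/negP; rewrite -ltNge.
apply: (@lt_le_trans _ _ 0); last exact: psi_ge0.
by rewrite nmulr_rlt0// powR_gt0// (lt_le_trans ltr01).
Qed.

Definition exact_set m (c : R) : set 'rV[R]_m :=
  Di m c `\` ((\bigcup_(e in [set e : R | 0 < e]) Di m (c - e)) `|` Bad R m).

Lemma not_Bad m (xi : 'rV[R]_m) : (0 < m)%N ->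
  (forall e Q0 : R, 0 < e ->
    exists2 Q, Q0 <= Q /\ 1 <= Q & psi xi Q ^+ m * Q <= e) -> ~ Bad R m xi.
Proof.
move=> m0 small; rewrite /Bad/=; apply/negP; rewrite -leNgt limf_einfE.
apply/ereal_supP => _ [V [M [_ MV]] <-]; apply/lee_addgt0Pr => e e0.
have [Q [MQ Q1] Qe] := small (e ^+ m) (M + 1) (exprn_gt0 m e0).
rewrite add0e; apply: (@le_trans _ _ (Q `^ m%:R^-1 * psi xi Q)%:E).
  apply: ereal_inf_lbound; exists Q => //; apply: MV.
  by rewrite (lt_le_trans _ MQ)// ltrDl.
have Q0 := lt_le_trans ltr01 Q1.
rewrite lee_fin mulrC -ler_pdivlMr ?powR_gt0// -powRN.
by rewrite le_mul_powRN ?psi_ge0// ltW.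
Qed.

Lemma Sing_sub_Di m (c : R) : (0 < m)%N -> 0 < c -> Sing R m `<=` Di m c.
Proof.
move=> m0 c0 xi /cvgrPdist_le /(_ c c0)[M [_ MP]].
exists (Num.max 1 (M + 1)) => [|Q]; first by rewrite le_max lexx.
rewrite ge_max => /andP[Q1 MQ]; have Q0 := lt_le_trans ltr01 Q1.
rewrite powRN ler_pdivlMr ?powR_gt0// mulrC; apply: le_trans (MP Q _).
  by rewrite sub0r normrN ler_norm.
by rewrite (lt_le_trans _ MQ)// ltrDl.
Qed.

Lemma exact_set_sub_FS m : (0 < m)%N -> exact_set (m := m) 2^-1 `<=` FS R m.
Proof.
move=> m0 xi [Dxi notDB]; split; first by exists 2^-1 => //=; lra.
move=> [Bxi|Sxi]; apply: notDB; first by right.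
left; exists 4^-1 => /=; first by lra.
by apply: Sing_sub_Di Sxi => //; lra.
Qed.

Lemma packing_dim_exact n (c : R) (E : set 'rV[R]_n.+1) : (0 < n)%N ->
  0 < c <= 1 -> exact_set c `<=` E -> (n%:R%:E <= packing_dim E)%E.
Proof.
move=> n0 c01 sub_E; have /andP[c0 c1] := c01.
have [a aP] := scale_exists n0 c01.
pose eps h : R := ((a h * h ^ n)%:R ^+ 4)^-1.
apply: (@packing_dim_ge_proj _ _ _ (ladder_approx_beyond eps)) => [B|eta etaP].
  split; first exact: open_ladder_approx_beyond.
  apply: dense_ladder_approx_beyond => h h0; have [a0 _ _] := aP _ h0.
  by rewrite invr_gt0 exprn_gt0// ltr0n muln_gt0 a0 expn_gt0 h0.
have [zeta [Dxi sharp bad]] := exact_vector_exists n0 c01 aP etaP.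
exists (row_cons zeta eta); last exact: col'_row_cons.
apply: sub_E; split; first by apply/Di_exprP => //; exact: ltW.
move=> [[e /= e0 De]|]; last exact: not_Bad.
have [ce|ce] := ltP (c - e) 0; first exact: Di_lt0 De.
have /Di_exprP[] // := De => Q0 _ small.
have := sharp _ _ ce small; lra.
Qed.

End ExactSet.

Theorem corollary1 (R : realType) (m : nat) (hm : (2 <= m)%N) :
  (forall c : R, 0 < c <= 1 ->
     ((m%:R - 1)%:E <=
      packing_dim (Di m c `\`
        ((\bigcup_(e in [set e : R | (0 < e)%R]) Di m (c - e)) `|` Bad R m)))%E) /\
  ((m%:R - 1)%:E <= packing_dim (FS R m))%E.
Proof.
case: m hm => // n n0.
have -> : n.+1%:R - 1 = n%:R :> R by rewrite -natr1 addrK.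
split=> [c c01|]; first exact: (packing_dim_exact n0 c01).
apply: (@packing_dim_exact _ _ 2^-1) => //; first by lra.
exact: exact_set_sub_FS.
Qed.
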